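(* (In $\mathsf{ZF}$.) If $M$ is an $H$-like set of successor type, then $M\models\mathsf{ZF}-\mathsf{Powerset}$.
   Context: $|X|\lesssim|Y|$ means $X=\emptyset$ or there is a surjection from $Y$ onto $X$. $X\in M$ is a maximal cardinality of $M$ if $M\models\forall Y(|Y|\lesssim|X|)$; $M$ is of successor type if it has a maximal cardinality. $M$ is full if it is transitively closed (for each $Y\in M$ there is a transitive $Z\in M$ with $Z\subseteq M$, $Y\in Z$), closed under products ($X\times Y\in M$ for $X,Y\in M$) and closed under subsets ($\mathscr{P}(X)\subseteq M$ for $X\in M$). $M$ is strongly regular if for every $X\in M$ and every function $f:X\to\mathsf{Ord}\cap M$, the range of $f$ is bounded in $\mathsf{Ord}\cap M$. $M$ is hierarchical if it is transitive and, with $\kappa=\mathsf{Ord}\cap M$, there is a $\subseteq$-increasing continuous sequence $\langle M_\alpha:\alpha<\kappa\rangle$ of transitive sets with union $M$ and each $M_\alpha\in M$. A transitive $M$ is $H$-like if it is full, hierarchical and (if of successor type) strongly regular. $\mathsf{ZF}-\mathsf{Powerset}$ is $\mathsf{ZF}$ without the Powerset axiom. *)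

(* Defs.v *)
Set Implicit Arguments.
Unset Strict Implicit.

(** * First-order language of set theory *)

(* Variables are de Bruijn indices. *)
Inductive form : Type :=
  | Mem (i j : nat)
  | Eq (i j : nat)
  | Bot
  | And (p q : form)
  | Or (p q : form)
  | Imp (p q : form)
  | All (p : form)
  | Ex (p : form).

Definition Not (p : form) : form := Imp p Bot.
Definition Iff (p q : form) : form := And (Imp p q) (Imp q p).

Definition up (r : nat -> nat) (n : nat) : nat :=
  match n with 0 => 0 | S m => S (r m) end.

Fixpoint ren (r : nat -> nat) (p : form) : form :=
  match p with
  | Mem i j => Mem (r i) (r j)
  | Eq i j => Eq (r i) (r j)
  | Bot => Bot
  | And p q => And (ren r p) (ren r q)
  | Or p q => Or (ren r p) (ren r q)
  | Imp p q => Imp (ren r p) (ren r q)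
  | All p => All (ren (up r) p)
  | Ex p => Ex (ren (up r) p)
  end.

Record structure : Type := Structure {
  carrier :> Type;
  mem : carrier -> carrier -> Prop
}.

Notation "x ∈ y" := (@mem _ x y) (at level 70, no associativity).

Definition scons (A : Type) (x : A) (rho : nat -> A) (n : nat) : A :=
  match n with 0 => x | S m => rho m end.

Fixpoint sat (V : structure) (rho : nat -> V) (p : form) : Prop :=
  match p with
  | Mem i j => rho i ∈ rho j
  | Eq i j => rho i = rho j
  | Bot => False
  | And p q => sat rho p /\ sat rho q
  | Or p q => sat rho p \/ sat rho q
  | Imp p q => sat rho p -> sat rho q
  | All p => forall x : V, sat (scons x rho) p
  | Ex p => exists x : V, sat (scons x rho) p
  end.

(* Axioms may have free variables (the parameters of the schemas); a structure
   is a model when it satisfies their universal closures. *)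
Definition models (V : structure) (T : form -> Prop) : Prop :=
  forall p : form, T p -> forall rho : nat -> V, sat rho p.

Notation "V ⊨ T" := (models V T) (at level 70, no associativity).

(** * The axioms of ZF *)

Definition ax_extensionality : form :=
  All (All (Imp (All (Iff (Mem 0 2) (Mem 0 1))) (Eq 1 0))).

Definition ax_foundation : form :=
  All (Imp (Ex (Mem 0 1))
           (Ex (And (Mem 0 1) (Not (Ex (And (Mem 0 2) (Mem 0 1))))))).

Definition ax_pairing : form :=
  All (All (Ex (All (Iff (Mem 0 1) (Or (Eq 0 3) (Eq 0 2)))))).

Definition ax_union : form :=
  All (Ex (All (Iff (Mem 0 1) (Ex (And (Mem 0 3) (Mem 1 0)))))).

Definition ax_infinity : form :=
  Ex (And (Ex (And (Mem 0 1) (All (Not (Mem 0 1)))))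
          (All (Imp (Mem 0 1)
                    (Ex (And (Mem 0 2)
                             (All (Iff (Mem 0 1) (Or (Mem 0 2) (Eq 0 2))))))))).

Definition ax_powerset : form :=
  All (Ex (All (Iff (Mem 0 1) (All (Imp (Mem 0 1) (Mem 0 3)))))).

(* forall a, exists b, forall x, x ∈ b <-> x ∈ a /\ p(x, a, ...);
   the variables of p are x = 0, a = 1 and parameters from 2 on. *)
Definition ax_separation (p : form) : form :=
  All (Ex (All (Iff (Mem 0 1) (And (Mem 0 2) (ren (up S) p))))).

Definition swap01 (n : nat) : nat :=
  match n with 0 => 1 | 1 => 0 | S (S m) => S (S (S m)) end.

(* forall a, (forall x ∈ a, forall y z, p(y, x, a, ...) /\ p(z, x, a, ...) -> y = z)
     -> exists b, forall y, y ∈ b <-> exists x ∈ a, p(y, x, a, ...);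
   the variables of p are y = 0, x = 1, a = 2 and parameters from 3 on. *)
Definition ax_replacement (p : form) : form :=
  All (Imp
    (All (Imp (Mem 0 1)
       (All (All (Imp (And (ren S p) (ren (up S) p)) (Eq 1 0))))))
    (Ex (All (Iff (Mem 0 1) (Ex (And (Mem 0 3) (ren swap01 p))))))).

Inductive ZF_minus_Powerset : form -> Prop :=
  | ZF_extensionality : ZF_minus_Powerset ax_extensionality
  | ZF_foundation : ZF_minus_Powerset ax_foundation
  | ZF_pairing : ZF_minus_Powerset ax_pairing
  | ZF_union : ZF_minus_Powerset ax_union
  | ZF_infinity : ZF_minus_Powerset ax_infinity
  | ZF_separation : forall p, ZF_minus_Powerset (ax_separation p)
  | ZF_replacement : forall p, ZF_minus_Powerset (ax_replacement p).

Definition ZF (p : form) : Prop := ZF_minus_Powerset p \/ p = ax_powerset.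

(** * Set-theoretic notions, evaluated in an arbitrary structure *)

Definition sub_set (V : structure) (x y : V) : Prop :=
  forall z : V, z ∈ x -> z ∈ y.

Definition transitive (V : structure) (x : V) : Prop :=
  forall y : V, y ∈ x -> sub_set y x.

Definition is_upair (V : structure) (p x y : V) : Prop :=
  forall z : V, z ∈ p <-> z = x \/ z = y.

(* Kuratowski pairs *)
Definition is_opair (V : structure) (p x y : V) : Prop :=
  exists a b : V, is_upair a x x /\ is_upair b x y /\ is_upair p a b.

Definition is_product (V : structure) (P X Y : V) : Prop :=
  forall p : V, p ∈ P <-> exists x y : V, x ∈ X /\ y ∈ Y /\ is_opair p x y.

Definition maps (V : structure) (f x y : V) : Prop :=
  exists p : V, p ∈ f /\ is_opair p x y.

Definition function_on (V : structure) (f X : V) : Prop :=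
  (forall p : V, p ∈ f -> exists x y : V, x ∈ X /\ is_opair p x y) /\
  (forall x : V, x ∈ X -> exists! y : V, maps f x y).

Definition surjection (V : structure) (f X Y : V) : Prop :=
  function_on f X /\ forall y : V, y ∈ Y <-> exists x : V, maps f x y.

(* |X| ≲ |Y| *)
Definition card_lesssim (V : structure) (X Y : V) : Prop :=
  (forall x : V, ~ x ∈ X) \/ exists f : V, surjection f Y X.

(* Transitive and strictly well-ordered by membership. *)
Definition ordinal (V : structure) (a : V) : Prop :=
  transitive a /\
  (forall x : V, x ∈ a -> ~ x ∈ x) /\
  (forall x y z : V, x ∈ a -> y ∈ a -> z ∈ a -> x ∈ y -> y ∈ z -> x ∈ z) /\
  (forall x y : V, x ∈ a -> y ∈ a -> x ∈ y \/ x = y \/ y ∈ x) /\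
  (forall s : V, sub_set s a -> (exists x : V, x ∈ s) ->
     exists x : V, x ∈ s /\ forall y : V, y ∈ s -> x = y \/ x ∈ y).

Definition limit_ordinal (V : structure) (a : V) : Prop :=
  ordinal a /\ (exists x : V, x ∈ a) /\
  forall x : V, x ∈ a -> exists y : V, y ∈ a /\ x ∈ y.

(** * H-like sets *)

(* The structure (M, ∈) of a set M of V. *)
Definition inner (V : structure) (M : V) : structure :=
  @Structure {x : V | x ∈ M} (fun x y => proj1_sig x ∈ proj1_sig y).

Definition maximal_cardinality (V : structure) (M : V) (X : inner M) : Prop :=
  forall Y : inner M, card_lesssim Y X.

Definition successor_type (V : structure) (M : V) : Prop :=
  exists X : inner M, maximal_cardinality X.

Definition transitively_closed (V : structure) (M : V) : Prop :=
  forall Y : V, Y ∈ M ->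
    exists Z : V, Z ∈ M /\ transitive Z /\ sub_set Z M /\ Y ∈ Z.

Definition closed_under_products (V : structure) (M : V) : Prop :=
  forall X Y : V, X ∈ M -> Y ∈ M -> exists P : V, P ∈ M /\ is_product P X Y.

Definition closed_under_subsets (V : structure) (M : V) : Prop :=
  forall X Y : V, X ∈ M -> sub_set Y X -> Y ∈ M.

Definition full (V : structure) (M : V) : Prop :=
  transitively_closed M /\ closed_under_products M /\ closed_under_subsets M.

Definition in_Ord (V : structure) (M a : V) : Prop := ordinal a /\ a ∈ M.

Definition strongly_regular (V : structure) (M : V) : Prop :=
  forall X f : V, X ∈ M -> function_on f X ->
    (forall x a : V, maps f x a -> in_Ord M a) ->
    exists b : V, in_Ord M b /\ forall x a : V, maps f x a -> a ∈ b \/ a = b.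

(* s is the sequence <M_a : a < k>, and [maps s a m] reads M_a = m. *)
Definition hierarchical (V : structure) (M : V) : Prop :=
  transitive M /\
  exists k s : V,
    (forall a : V, a ∈ k <-> in_Ord M a) /\
    function_on s k /\
    (forall a m : V, maps s a m -> transitive m /\ m ∈ M) /\
    (forall a b m n : V, a ∈ b -> maps s a m -> maps s b n -> sub_set m n) /\
    (forall l m : V, limit_ordinal l -> maps s l m ->
       forall x : V, x ∈ m <-> exists a n : V, a ∈ l /\ maps s a n /\ x ∈ n) /\
    (forall x : V, x ∈ M <-> exists a n : V, maps s a n /\ x ∈ n).

Definition H_like (V : structure) (M : V) : Prop :=
  transitive M /\ full M /\ hierarchical M /\
  (successor_type M -> strongly_regular M).

(* Main.v *)
From Stdlib Require Import Classical FunctionalExtensionality ProofIrrelevance PeanoNat.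
Require Import Defs.

(** Separation in M holds because M is closed under subsets.  For Replacement, send each
    argument x to the least level of the hierarchy containing the value at x; strong
    regularity bounds these levels, so the range is a subset of a single level, which
    belongs to M.

    Infinity is witnessed by any limit ordinal of M.  If there were none, every ordinal
    of M would be zero or a successor.  By ∈-induction and strong regularity every
    element of M would then have its rank bounded by such an ordinal.  The sets W_n of
    elements of rank at most n satisfy W_(n+1) = P(W_n), so inductively they are finite
    and belong to M.  A maximal cardinality X would be contained in some W_n while
    P(W_n) belongs to M, so X would surject onto P(W_n), against Cantor.

    The ambient universe only has first-order Separation, so every comprehension is
    accompanied by a proof that the predicate is definable from parameters. *)

(** * Definability with parameters *)

Lemma sat_ren (W : structure) (p : form) :
  forall (f : nat -> nat) (rho : nat -> W),
    sat rho (ren f p) <-> sat (fun n => rho (f n)) p.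
Proof.
  assert (E : forall (f : nat -> nat) (rho : nat -> W) x,
    (fun n => scons x rho (up f n)) = scons x (fun n => rho (f n))).
  { intros f rho x; extensionality n; destruct n; reflexivity. }
  induction p as [i j|i j| |p IHp q IHq|p IHp q IHq|p IHp q IHq|p IHp|p IHp];
    intros f rho; simpl; try reflexivity;
    try (rewrite IHp, IHq; reflexivity).
  - split; intros H x; specialize (H x); rewrite IHp, E in *; exact H.
  - split; intros [x H]; exists x; rewrite IHp, E in *; exact H.
Qed.

Section Definability.

Context {V : structure}.

(** A slot of a formula holds either a variable [inl i], read from the assignment, or a parameter
    [inr c] fixed in the universe. *)
Definition value (r : nat -> V) (u : nat + V) : V :=
  match u with inl i => r i | inr c => c end.

(** Predicates act on whole assignments rather than on tuples, so that definability is closed under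
    connectives and quantifiers without any bookkeeping of arities. *)
Definition definable (P : (nat -> V) -> Prop) : Prop :=
  exists (p : form) (e : nat -> nat + V),
    forall r, P r <-> sat (fun n => value r (e n)) p.

Definition definable_term (t : (nat -> V) -> V) : Prop :=
  exists u, forall r, t r = value r u.

Lemma definable_var (i : nat) : definable_term (fun r => r i).
Proof. exists (inl i); reflexivity. Qed.

Lemma definable_const (c : V) : definable_term (fun _ => c).
Proof. exists (inr c); reflexivity. Qed.

(** The two slot tables are interleaved: the first formula is renamed to even slots, the second to
    odd ones, and a single table then serves both. *)
Lemma definable_common (P Q : (nat -> V) -> Prop) :
  definable P -> definable Q ->
  exists p q e, forall r, (P r <-> sat (fun n => value r (e n)) p) /\
                          (Q r <-> sat (fun n => value r (e n)) q).
Proof.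
  intros [p [e1 Hp]] [q [e2 Hq]].
  exists (ren (fun n => 2 * n) p), (ren (fun n => S (2 * n)) q),
    (fun n => if Nat.even n then e1 (Nat.div2 n) else e2 (Nat.div2 n)).
  intros r; rewrite !sat_ren, Hp, Hq.
  split.
  - replace (fun n => value r (e1 n)) with (fun n => value r
      (if Nat.even (2 * n) then e1 (Nat.div2 (2 * n)) else e2 (Nat.div2 (2 * n)))).
    + reflexivity.
    + extensionality n; now rewrite Nat.even_even, Nat.div2_double.
  - replace (fun n => value r (e2 n)) with (fun n => value r
      (if Nat.even (S (2 * n)) then e1 (Nat.div2 (S (2 * n)))
       else e2 (Nat.div2 (S (2 * n))))).
    + reflexivity.
    + extensionality n; rewrite Nat.div2_succ_double.
      replace (S (2 * n)) with (2 * n + 1) by apply Nat.add_1_r.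
      now rewrite Nat.even_odd.
Qed.

Lemma definable_and (P Q : (nat -> V) -> Prop) :
  definable P -> definable Q -> definable (fun r => P r /\ Q r).
Proof.
  intros HP HQ; destruct (definable_common _ _ HP HQ) as [p [q [e H]]].
  exists (And p q), e; intros r; simpl; destruct (H r); tauto.
Qed.

Lemma definable_or (P Q : (nat -> V) -> Prop) :
  definable P -> definable Q -> definable (fun r => P r \/ Q r).
Proof.
  intros HP HQ; destruct (definable_common _ _ HP HQ) as [p [q [e H]]].
  exists (Or p q), e; intros r; simpl; destruct (H r); tauto.
Qed.

Lemma definable_imp (P Q : (nat -> V) -> Prop) :
  definable P -> definable Q -> definable (fun r => P r -> Q r).
Proof.
  intros HP HQ; destruct (definable_common _ _ HP HQ) as [p [q [e H]]].
  exists (Imp p q), e; intros r; simpl; destruct (H r); tauto.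
Qed.

Lemma definable_False : definable (fun _ => False).
Proof. exists Bot, inl; intros r; simpl; tauto. Qed.

Lemma definable_mem (t u : (nat -> V) -> V) :
  definable_term t -> definable_term u -> definable (fun r => t r ∈ u r).
Proof.
  intros [i Hi] [j Hj]; exists (Mem 0 1), (fun n => match n with 0 => i | _ => j end).
  intros r; simpl; rewrite Hi, Hj; reflexivity.
Qed.

Lemma definable_eq (t u : (nat -> V) -> V) :
  definable_term t -> definable_term u -> definable (fun r => t r = u r).
Proof.
  intros [i Hi] [j Hj]; exists (Eq 0 1), (fun n => match n with 0 => i | _ => j end).
  intros r; simpl; rewrite Hi, Hj; reflexivity.
Qed.

(* The bound variable, wherever [e] uses it, is renamed to the de Bruijn index 0. *)
Lemma definable_bind (Q : V -> (nat -> V) -> Prop) :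
  definable (fun r => Q (r 0) (fun n => r (S n))) ->
  exists p e, forall r x, Q x r <-> sat (scons x (fun n => value r (e n))) p.
Proof.
  intros [p [e H]].
  exists (ren (fun n => match e n with inl 0 => 0 | _ => S n end) p),
    (fun n => match e n with inl (S i) => inl i | u => u end).
  intros r x; rewrite sat_ren.
  specialize (H (scons x r)); simpl in H.
  change (fun n => r n) with r in H; rewrite H.
  replace (fun n => value (scons x r) (e n)) with
    (fun n => scons x (fun n => value r (match e n with inl (S i) => inl i | u => u end))
       (match e n with inl 0 => 0 | _ => S n end)).
  - reflexivity.
  - extensionality n; destruct (e n) as [[|i]|c] eqn:E; simpl; try rewrite E; reflexivity.
Qed.

Lemma definable_all (Q : V -> (nat -> V) -> Prop) :
  definable (fun r => Q (r 0) (fun n => r (S n))) ->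
  definable (fun r => forall x, Q x r).
Proof.
  intros H; destruct (definable_bind _ H) as [p [e E]]; exists (All p), e.
  intros r; simpl; split; intros H' x; apply E, H'.
Qed.

Lemma definable_ex (Q : V -> (nat -> V) -> Prop) :
  definable (fun r => Q (r 0) (fun n => r (S n))) ->
  definable (fun r => exists x, Q x r).
Proof.
  intros H; destruct (definable_bind _ H) as [p [e E]]; exists (Ex p), e.
  intros r; simpl; split; intros [x H']; exists x; apply E, H'.
Qed.

(** Allows a definability hypothesis on an abstract predicate to be reused with arbitrary variables
    or parameters as arguments. *)
Lemma definable_subst (P : (nat -> V) -> Prop) (u : nat -> nat + V) :
  definable P -> definable (fun r => P (fun i => value r (u i))).
Proof.
  intros [p [e H]].
  exists p, (fun n => match e n with inl i => u i | inr c => inr c end).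
  intros r; rewrite H.
  replace (fun n => value r (match e n with inl i => u i | inr c => inr c end))
    with (fun n => value (fun i => value r (u i)) (e n)); [reflexivity|].
  extensionality n; destruct (e n); reflexivity.
Qed.

Lemma definable_app1 (P : V -> Prop) (t : (nat -> V) -> V) :
  definable (fun r => P (r 0)) -> definable_term t -> definable (fun r => P (t r)).
Proof.
  intros H [i Hi].
  destruct (definable_subst _ (fun _ => i) H) as [p [e E]].
  exists p, e; intros r; rewrite Hi; apply E.
Qed.

Lemma definable_app2 (G : V -> V -> Prop) (t u : (nat -> V) -> V) :
  definable (fun r => G (r 0) (r 1)) -> definable_term t -> definable_term u ->
  definable (fun r => G (t r) (u r)).
Proof.
  intros H [i Hi] [j Hj].
  destruct (definable_subst _ (fun n => match n with 0 => i | _ => j end) H)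
    as [p [e E]].
  exists p, e; intros r; rewrite Hi, Hj; apply E.
Qed.

End Definability.

(** * Finiteness, power sets and bounded rank in first-order form *)

Section SetOperations.

Context {V : structure}.

Definition is_empty (e : V) : Prop := forall z, ~ z ∈ e.

Definition is_adjunction (U A a : V) : Prop := forall z, z ∈ U <-> z ∈ A \/ z = a.

Definition is_powerset (Q A : V) : Prop := forall z, z ∈ Q <-> sub_set z A.

(* Kuratowski finiteness. *)
Definition finite (Z : V) : Prop :=
  forall S : V, (forall e, is_empty e -> e ∈ S) ->
    (forall Y a U, Y ∈ S -> a ∈ Z -> is_adjunction U Y a -> U ∈ S) -> Z ∈ S.

(* For an ordinal [n], this says that the rank of [x] is at most [n], witnessed by a
   relation [R] containing (n, x) along which membership descends; asking for a
   witness avoids transfinite recursion. *)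
Definition height_le (n x : V) : Prop :=
  exists R : V, (forall m y, maps R m y -> forall z, z ∈ y ->
                   exists j, j ∈ m /\ maps R j z) /\ maps R n x.

End SetOperations.

Ltac definability :=
  cbv beta delta [not iff height_le finite is_empty is_adjunction is_powerset maps
    is_opair is_upair sub_set];
  repeat (cbv beta;
    match goal with
    | H : definable (fun r => ?P (r 0)) |- definable (fun r => ?P (@?t r)) =>
        apply (definable_app1 P t H)
    | H : definable (fun r => ?G (r 0) (r 1)) |- definable (fun r => ?G (@?t r) (@?u r)) =>
        apply (definable_app2 G t u H)
    | |- definable (fun r => _ ∈ _) => apply definable_mem
    | |- definable (fun r => _ = _) => apply definable_eq
    | |- definable (fun r => _ /\ _) => apply definable_and
    | |- definable (fun r => _ \/ _) => apply definable_or
    | |- definable (fun r => False) => apply definable_False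
    | |- definable (fun r => exists x, _) => apply definable_ex
    | |- definable (fun r => _ -> _) => apply definable_imp
    | |- definable (fun r => forall x, _) => apply definable_all
    | |- definable_term (fun r => r _) => apply definable_var
    | |- definable_term _ => apply definable_const
    end).

(** * Basic set theory in a model of ZF *)

Section Universe.

Context {V : structure} (V_ZF : V ⊨ ZF).

Lemma extensionality (x y : V) : (forall z, z ∈ x <-> z ∈ y) -> x = y.
Proof.
  exact (V_ZF _ (or_introl ZF_extensionality) (fun _ => x) x y).
Qed.

Lemma foundation (a : V) :
  (exists x, x ∈ a) -> exists x, x ∈ a /\ ~ exists y, y ∈ a /\ y ∈ x.
Proof.
  exact (V_ZF _ (or_introl ZF_foundation) (fun _ => a) a).
Qed.

Lemma upair_exists (x y : V) : exists p, is_upair p x y.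
Proof.
  exact (V_ZF _ (or_introl ZF_pairing) (fun _ => x) x y).
Qed.

Lemma union_exists (a : V) : exists u, forall z, z ∈ u <-> exists y, y ∈ a /\ z ∈ y.
Proof.
  exact (V_ZF _ (or_introl ZF_union) (fun _ => a) a).
Qed.

Lemma powerset_exists (a : V) : exists q, is_powerset q a.
Proof.
  exact (V_ZF _ (or_intror eq_refl) (fun _ => a) a).
Qed.

Lemma separation (P : V -> Prop) (a : V) :
  definable (fun r => P (r 0)) -> exists b, forall x, x ∈ b <-> x ∈ a /\ P x.
Proof.
  intros [p [e H]].
  (* [P] reads only [r 0], so [H] can be used at the constant assignment [x] and every variable
     collapses to index 0. Parameters start at index 2, because index 1 of the schema is the
     bounding set. In [rho], [a] is only a filler at the variable slots. *)
  pose (f := fun n => match e n with inl _ => 0 | inr _ => S (S n) end).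
  pose (rho := fun n => match e n with inl _ => a | inr c => c end).
  destruct (V_ZF _ (or_introl (ZF_separation (ren f p))) rho a) as [b Hb].
  exists b; intros x; specialize (Hb x); cbn in Hb; rewrite !sat_ren in Hb.
  rewrite (H (fun _ => x)).
  replace (fun n => value (fun _ => x) (e n)) with
    (fun n => scons x (scons b (scons a rho)) (up S (f n))); [exact Hb|].
  extensionality n; unfold f, rho; destruct (e n) eqn:E; simpl; try rewrite E; reflexivity.
Qed.

Lemma binary_union_exists (A B : V) : exists U, forall z, z ∈ U <-> z ∈ A \/ z ∈ B.
Proof.
  destruct (upair_exists A B) as [p Hp]; destruct (union_exists p) as [U HU].
  exists U; intros z; rewrite HU; split.
  - intros [y [Hy Hz]]; apply Hp in Hy; destruct Hy; subst; tauto.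
  - intros [H|H]; eexists; (split; [apply Hp|exact H]); tauto.
Qed.

Lemma adjunction_exists (A a : V) : exists U, is_adjunction U A a.
Proof.
  destruct (upair_exists a a) as [p Hp]; destruct (binary_union_exists A p) as [U HU].
  exists U; intros z; rewrite HU, (Hp z); tauto.
Qed.

(** Foundation for the subset of [a] cut out by [P]. Applied to counterexamples it replaces
    ∈-induction and induction on ordinals. *)
Lemma minimal_element (P : V -> Prop) (a : V) :
  definable (fun r => P (r 0)) -> (exists x, x ∈ a /\ P x) ->
  exists x, x ∈ a /\ P x /\ forall y, y ∈ a -> P y -> ~ y ∈ x.
Proof.
  intros D [x [Hx Px]]; destruct (separation P a D) as [b Hb].
  destruct (foundation b) as [m [Hm N]].
  - exists x; apply Hb; tauto.
  - apply Hb in Hm; exists m; repeat split; try tauto.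
    intros y Hy Py Hym; apply N; exists y; rewrite Hb; tauto.
Qed.

Lemma no_mem_cycle3 (x y z : V) : x ∈ y -> y ∈ z -> ~ z ∈ x.
Proof.
  intros Hxy Hyz Hzx.
  destruct (upair_exists x y) as [p Hp]; destruct (adjunction_exists p z) as [t Ht].
  assert (Et : forall w, w ∈ t <-> w = x \/ w = y \/ w = z).
  { intros w; rewrite (Ht w), (Hp w); tauto. }
  destruct (foundation t) as [m [Hm N]].
  - exists x; apply Et; tauto.
  - apply N; apply Et in Hm; destruct Hm as [E|[E|E]]; subst m.
    + exists z; rewrite Et; tauto.
    + exists x; rewrite Et; tauto.
    + exists y; rewrite Et; tauto.
Qed.

Lemma no_mem_self (x : V) : ~ x ∈ x.
Proof. intros H; exact (no_mem_cycle3 x x x H H H). Qed.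

Lemma no_mem_cycle2 (x y : V) : x ∈ y -> ~ y ∈ x.
Proof.
  intros Hxy Hyx; destruct (upair_exists x y) as [t Et].
  destruct (foundation t) as [m [Hm N]].
  - exists x; apply Et; tauto.
  - apply N; apply Et in Hm; destruct Hm as [E|E]; subst m.
    + exists y; rewrite (Et y); tauto.
    + exists x; rewrite (Et x); tauto.
Qed.

(** * Kuratowski pairs and definable relations *)

Lemma opair_inj (p x y x' y' : V) :
  is_opair p x y -> is_opair p x' y' -> x = x' /\ y = y'.
Proof.
  intros [a [b [Ha [Hb Hp]]]] [a' [b' [Ha' [Hb' Hp']]]].
  assert (Ex : x = x').
  { assert (H : a = a' \/ a = b') by (apply Hp', Hp; tauto).
    assert (Hx : x' ∈ a).
    { destruct H; subst; [apply Ha'|apply Hb']; tauto. }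
    apply Ha in Hx; intuition congruence. }
  subst x'; split; [reflexivity|].
  assert (Ea : a = a').
  { apply extensionality; intros z; rewrite (Ha z), (Ha' z); tauto. }
  subst a'.
  assert (H1 : b = a \/ b = b') by (apply Hp', Hp; tauto).
  assert (H2 : b' = a \/ b' = b) by (apply Hp, Hp'; tauto).
  assert (Hy : y ∈ b) by (apply Hb; tauto).
  assert (Hy' : y' ∈ b') by (apply Hb'; tauto).
  assert (C : b = b').
  { destruct H1, H2; congruence. }
  subst b'; apply Hb' in Hy; apply Hb in Hy'.
  destruct Hy, Hy'; congruence.
Qed.

Lemma opair_exists (x y : V) : exists p, is_opair p x y.
Proof.
  destruct (upair_exists x x) as [a Ha]; destruct (upair_exists x y) as [b Hb].
  destruct (upair_exists a b) as [p Hp]; exists p, a, b; tauto.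
Qed.

(** A pair with components in [A] and [B] is a set of subsets of [A ∪ B], so the relation can be
    separated from the double power set of [A ∪ B]. *)
Lemma relation_exists (G : V -> V -> Prop) (A B : V) :
  definable (fun r => G (r 0) (r 1)) ->
  exists R, (forall p, p ∈ R -> exists x y, x ∈ A /\ is_opair p x y) /\
            forall x y, maps R x y <-> x ∈ A /\ y ∈ B /\ G x y.
Proof.
  intros D; destruct (binary_union_exists A B) as [U HU].
  destruct (powerset_exists U) as [Q HQ]; destruct (powerset_exists Q) as [QQ HQQ].
  destruct (separation (fun p => exists x y, x ∈ A /\ y ∈ B /\ G x y /\ is_opair p x y) QQ)
    as [R HR]; [definability|].
  exists R; split.
  - intros p Hp; apply HR in Hp; destruct Hp as [_ [x [y H]]]; exists x, y; tauto.
  - intros x y; split.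
    + intros [p [Hp E]]; apply HR in Hp; destruct Hp as [_ [x' [y' [Hx [Hy [H E']]]]]].
      destruct (opair_inj _ _ _ _ _ E E'); subst; tauto.
    + intros [Hx [Hy H]]; destruct (opair_exists x y) as [p Hp].
      exists p; split; [|exact Hp]; apply HR; split; [|exists x, y; tauto].
      destruct Hp as [a [b [Ha [Hb Hp]]]].
      apply HQQ; intros c Hc; apply HQ; intros z Hz; apply HU.
      apply Hp in Hc; destruct Hc; subst c; [apply Ha in Hz|apply Hb in Hz];
        destruct Hz; subst; tauto.
Qed.

(** * Ordinals *)

(** Foundation excludes membership cycles and provides minimal elements, which yields the remaining
    clauses of [ordinal]. *)
Lemma ordinal_intro (a : V) : transitive a ->
  (forall x y, x ∈ a -> y ∈ a -> x ∈ y \/ x = y \/ y ∈ x) -> ordinal a.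
Proof.
  intros T C; split; [exact T|]; split; [intros; apply no_mem_self|].
  split; [|split; [exact C|]].
  - intros x y z Hx _ Hz Hxy Hyz; destruct (C x z Hx Hz) as [H|[H|H]]; [exact H| |].
    + subst; destruct (no_mem_cycle2 _ _ Hxy Hyz).
    + destruct (no_mem_cycle3 _ _ _ Hxy Hyz H).
  - intros s Hs Ne; destruct (foundation s Ne) as [x [Hx N]].
    exists x; split; [exact Hx|]; intros y Hy.
    destruct (C x y (Hs _ Hx) (Hs _ Hy)) as [H|[H|H]]; try tauto.
    exfalso; apply N; exists y; tauto.
Qed.

Lemma ordinal_mem (a x : V) : ordinal a -> x ∈ a -> ordinal x.
Proof.
  intros [T [_ [Tr [C _]]]] Hx; apply ordinal_intro.
  - intros y Hy z Hz; apply (Tr z y x); try tauto.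
    + exact (T y (T x Hx y Hy) z Hz).
    + exact (T x Hx y Hy).
  - intros y z Hy Hz; apply C; apply (T x Hx); assumption.
Qed.

Lemma ordinal_succ (a b : V) : ordinal a -> is_adjunction b a a -> ordinal b.
Proof.
  intros [T [_ [_ [C _]]]] Hb; apply ordinal_intro.
  - intros x Hx y Hy; apply Hb in Hx; apply Hb; destruct Hx as [Hx|Hx]; subst; try tauto.
    left; exact (T x Hx y Hy).
  - intros x y Hx Hy; apply Hb in Hx; apply Hb in Hy.
    destruct Hx, Hy; subst; auto.
Qed.

(** If [c] is a proper subset, the ∈-least element of [a] outside [c] is [c] itself. *)
Lemma transitive_subset_ordinal (a c : V) :
  ordinal a -> transitive c -> sub_set c a -> c = a \/ c ∈ a.
Proof.
  intros [T [_ [_ [C _]]]] Tc S.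
  destruct (classic (exists x, x ∈ a /\ ~ x ∈ c)) as [E|N].
  - destruct (minimal_element (fun x => ~ x ∈ c) a) as [x [Hx [Nx Min]]];
      [definability|exact E|].
    right; replace c with x; [exact Hx|]; apply extensionality; intros z; split; intros Hz.
    + apply NNPP; intros Nz; exact (Min z (T x Hx z Hz) Nz Hz).
    + destruct (C z x (S _ Hz) Hx) as [H|[H|H]]; [exact H| |].
      * subst; contradiction.
      * destruct (Nx (Tc z Hz x H)).
  - left; apply extensionality; intros z; split; [apply S|].
    intros Hz; apply NNPP; intros Nz; apply N; exists z; tauto.
Qed.

(** The intersection [c] of [a] and [b] is transitive, hence equal to or a member of each of them;
    being a member of both would give [c ∈ c]. *)
Lemma ordinal_compare (a b : V) : ordinal a -> ordinal b -> a ∈ b \/ a = b \/ b ∈ a.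
Proof.
  intros Oa Ob; destruct (separation (fun z => z ∈ b) a) as [c Hc]; [definability|].
  assert (Tc : transitive c).
  { intros x Hx y Hy; apply Hc in Hx; apply Hc; split.
    - exact (proj1 Oa x (proj1 Hx) y Hy).
    - exact (proj1 Ob x (proj2 Hx) y Hy). }
  destruct (transitive_subset_ordinal a c Oa Tc) as [H|H];
    [intros z Hz; apply Hc in Hz; tauto| |];
    (destruct (transitive_subset_ordinal b c Ob Tc) as [H'|H'];
      [intros z Hz; apply Hc in Hz; tauto| |]); subst; try tauto.
  exfalso; apply (no_mem_self c), Hc; tauto.
Qed.

(** * Finite sets *)

Lemma finite_empty (e : V) : is_empty e -> finite e.
Proof. intros He S H _; exact (H e He). Qed.

Lemma finite_adjunction (Z a U : V) : finite Z -> is_adjunction U Z a -> finite U.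
Proof.
  intros F HU S H0 H1; apply (H1 Z a U); [|apply HU; tauto|exact HU].
  apply F; [exact H0|]; intros Y b W HY Hb; apply H1; [exact HY|apply HU; tauto].
Qed.

(** The definition of [finite] is applied to the set of subsets of [Z] satisfying [P]; this is why
    the step may assume [Y] to be a subset of [Z]. *)
Lemma finite_induction (P : V -> Prop) (Z : V) :
  definable (fun r => P (r 0)) -> finite Z ->
  (forall e, is_empty e -> P e) ->
  (forall Y a U, sub_set Y Z -> a ∈ Z -> is_adjunction U Y a -> P Y -> P U) -> P Z.
Proof.
  intros D F H0 H1; destruct (powerset_exists Z) as [Q HQ].
  destruct (separation P Q D) as [S HS].
  apply HS, F.
  - intros e He; apply HS; split; [apply HQ; intros z Hz; destruct (He z Hz)|exact (H0 e He)].
  - intros Y a U HY Ha HU; apply HS in HY; destruct HY as [HY PY]; apply HQ in HY.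
    apply HS; split; [|exact (H1 Y a U HY Ha HU PY)].
    apply HQ; intros z Hz; apply HU in Hz; destruct Hz; [auto|subst; exact Ha].
Qed.

(** A subset of [Y ∪ {a}] either omits [a], or is its trace on [Y] with [a] adjoined. *)
Lemma powerset_adjunction (Y a U Q Q' : V) :
  is_adjunction U Y a -> is_powerset Q Y -> is_powerset Q' U ->
  forall z, z ∈ Q' <-> z ∈ Q \/ exists t, t ∈ Q /\ is_adjunction z t a.
Proof.
  intros HU HQ HQ' z; rewrite (HQ' z), (HQ z); split.
  - intros Hz; destruct (classic (a ∈ z)) as [Ha|Na].
    + right; destruct (separation (fun w => w ∈ Y) z) as [t Ht]; [definability|].
      exists t; split; [apply HQ; intros w Hw; apply Ht in Hw; tauto|].
      intros w; rewrite Ht; split.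
      * intros Hw; destruct (proj1 (HU w) (Hz w Hw)); tauto.
      * intros [H|H]; subst; tauto.
    + left; intros w Hw; destruct (proj1 (HU w) (Hz w Hw)); [assumption|subst; contradiction].
  - intros [H|[t [Ht Hz]]] w Hw; apply HU.
    + left; auto.
    + apply Hz in Hw; apply HQ in Ht; destruct Hw; [left; auto|tauto].
Qed.

(** Two nested inductions. The outer one adjoins [a] to [Y]; the inner one runs over the finite
    power set of [Y] and adds the new subsets [t ∪ {a}] one at a time. *)
Lemma finite_powerset (Z Q : V) : finite Z -> is_powerset Q Z -> finite Q.
Proof.
  intros F; revert Q.
  apply (finite_induction (fun Z => forall Q, is_powerset Q Z -> finite Q) Z);
    [definability|exact F| |].
  - intros e He Q HQ; apply (finite_adjunction e e Q (finite_empty e He)).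
    intros z; rewrite (HQ z); split.
    + intros Hz; right; apply extensionality; intros w; split; intros Hw;
        [exact (Hz w Hw)|destruct (He w Hw)].
    + intros [Hz|Hz]; [destruct (He z Hz)|subst; intros w Hw; exact Hw].
  - intros Y a U _ _ HU IH Q' HQ'; destruct (powerset_exists Y) as [Q HQ].
    assert (FQ := IH Q HQ).
    assert (H : forall R, (forall z, z ∈ R <-> z ∈ Q \/ exists t, t ∈ Q /\ is_adjunction z t a)
                 -> finite R).
    (* Here [T] is the part of [Q] treated so far, and [R] is [Q] together with the sets [t ∪ {a}]
       for [t ∈ T]. *)
    { apply (finite_induction (fun T => forall R,
        (forall z, z ∈ R <-> z ∈ Q \/ exists t, t ∈ T /\ is_adjunction z t a) -> finite R) Q);
        [definability|exact FQ| |].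
      - intros e He R HR; replace R with Q; [exact FQ|].
        apply extensionality; intros z; rewrite HR; split; [tauto|].
        intros [H|[t [Ht _]]]; [exact H|destruct (He t Ht)].
      - intros T t T' _ _ HT' IHT R HR.
        destruct (separation (fun z => z ∈ Q \/ exists t, t ∈ T /\ is_adjunction z t a) R)
          as [R0 HR0]; [definability|].
        destruct (adjunction_exists t a) as [u Hu].
        apply (finite_adjunction R0 u R).
        + apply IHT; intros z; rewrite HR0, HR; split; [tauto|].
          intros H; split; [|exact H].
          destruct H as [H|[t' [Ht' E]]]; [tauto|].
          right; exists t'; split; [apply HT'; tauto|exact E].
        + intros z; rewrite HR0, HR; split.
          * intros [H|[t' [Ht' E]]]; [tauto|].
            destruct (proj1 (HT' t') Ht') as [H|H].
            { left; split; right; exists t'; tauto. }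
            { right; subst; apply extensionality; intros w; rewrite (E w), (Hu w); tauto. }
          * intros [H|H]; [tauto|].
            subst; right; exists t; split; [apply HT'; tauto|exact Hu]. }
    apply H; exact (powerset_adjunction Y a U Q Q' HU HQ HQ').
Qed.

(** * Satisfaction in the inner structure *)

Section Inner.

Context (M : V) (trans_M : transitive M).

Lemma inner_ext (x y : inner M) : proj1_sig x = proj1_sig y -> x = y.
Proof.
  destruct x as [x Hx], y as [y Hy]; simpl; intros E; subst.
  f_equal; apply proof_irrelevance.
Qed.

(** Truth in [inner M] expressed by bounding quantifiers by [M], over assignments in the universe.
    In this form it is definable there, so ambient Separation applies to it. *)
Fixpoint relsat (r : nat -> V) (p : form) : Prop :=
  match p with
  | Mem i j => r i ∈ r j
  | Eq i j => r i = r j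
  | Bot => False
  | And p q => relsat r p /\ relsat r q
  | Or p q => relsat r p \/ relsat r q
  | Imp p q => relsat r p -> relsat r q
  | All p => forall x : V, x ∈ M -> relsat (scons x r) p
  | Ex p => exists x : V, x ∈ M /\ relsat (scons x r) p
  end.

Lemma scons_proj (x : inner M) (rho : nat -> inner M) :
  (fun n => proj1_sig (scons x rho n)) =
  scons (proj1_sig x) (fun n => proj1_sig (rho n)).
Proof. extensionality n; destruct n; reflexivity. Qed.

Lemma sat_inner (p : form) :
  forall rho : nat -> inner M, sat rho p <-> relsat (fun n => proj1_sig (rho n)) p.
Proof.
  induction p as [i j|i j| |p IHp q IHq|p IHp q IHq|p IHp q IHq|p IHp|p IHp];
    intros rho; simpl; try reflexivity;
    try (rewrite IHp, IHq; reflexivity).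
  - split; [congruence|apply inner_ext].
  - split.
    + intros H x Hx; specialize (H (exist _ x Hx)).
      rewrite IHp, scons_proj in H; exact H.
    + intros H x; rewrite IHp, scons_proj; apply H, proj2_sig.
  - split.
    + intros [x H]; rewrite IHp, scons_proj in H.
      exists (proj1_sig x); split; [apply proj2_sig|exact H].
    + intros [x [Hx H]]; exists (exist _ x Hx); rewrite IHp, scons_proj; exact H.
Qed.

Lemma sat_ren_inner (p : form) (f : nat -> nat) (rho : nat -> inner M) (e : nat -> V) :
  (forall n, proj1_sig (rho (f n)) = e n) -> sat rho (ren f p) <-> relsat e p.
Proof.
  intros H; rewrite sat_ren, sat_inner.
  replace e with (fun n => proj1_sig (rho (f n))); [reflexivity|].
  extensionality n; apply H.
Qed.

Lemma scons_eta (r : nat -> V) : scons (r 0) (fun n => r (S n)) = r.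
Proof. extensionality n; destruct n; reflexivity. Qed.

Lemma definable_relsat (p : form) : definable (fun r => relsat r p).
Proof.
  induction p as [i j|i j| |p IHp q IHq|p IHp q IHq|p IHp q IHq|p IHp|p IHp]; simpl.
  - definability.
  - definability.
  - definability.
  - apply definable_and; assumption.
  - apply definable_or; assumption.
  - apply definable_imp; assumption.
  - apply definable_all, definable_imp; [definability|].
    replace (fun r => relsat (scons (r 0) (fun n => r (S n))) p) with
      (fun r => relsat r p); [exact IHp|].
    extensionality r; rewrite scons_eta; reflexivity.
  - apply definable_ex, definable_and; [definability|].
    replace (fun r => relsat (scons (r 0) (fun n => r (S n))) p) with
      (fun r => relsat r p); [exact IHp|].
    extensionality r; rewrite scons_eta; reflexivity.
Qed.

Lemma definable_relsat1 (p : form) (s : nat -> V) :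
  definable (fun r => relsat (scons (r 0) s) p).
Proof.
  destruct (definable_subst _ (scons (inl 0) (fun n => inr (s n))) (definable_relsat p))
    as [q [e H]].
  exists q, e; intros r; rewrite <- H.
  replace (fun i => value r (scons (inl 0) (fun n => inr (s n)) i)) with (scons (r 0) s);
    [reflexivity|].
  extensionality n; destruct n; reflexivity.
Qed.

Lemma definable_relsat2 (p : form) (s : nat -> V) :
  definable (fun r => relsat (scons (r 0) (scons (r 1) s)) p).
Proof.
  destruct (definable_subst _ (scons (inl 0) (scons (inl 1) (fun n => inr (s n))))
    (definable_relsat p)) as [q [e H]].
  exists q, e; intros r; rewrite <- H.
  replace (fun i => value r (scons (inl 0) (scons (inl 1) (fun n => inr (s n))) i))
    with (scons (r 0) (scons (r 1) s)); [reflexivity|].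
  extensionality n; destruct n as [|[|n]]; reflexivity.
Qed.

(** * Absoluteness of pairs, and Cantor's theorem inside M *)

Lemma inner_upair (p x y : inner M) :
  is_upair p x y <-> is_upair (proj1_sig p) (proj1_sig x) (proj1_sig y).
Proof.
  split; intros H z.
  - split.
    + intros Hz; specialize (H (exist _ z (trans_M _ (proj2_sig p) _ Hz))); cbn in H.
      destruct (proj1 H Hz) as [E|E]; rewrite <- E; auto.
    + intros [E|E]; subst z; [apply (proj2 (H x))|apply (proj2 (H y))]; auto.
  - specialize (H (proj1_sig z)); cbn; rewrite H.
    split; (intros [E|E]; [left|right]); (apply inner_ext, E || congruence).
Qed.

Lemma inner_opair (p x y : inner M) :
  is_opair p x y <-> is_opair (proj1_sig p) (proj1_sig x) (proj1_sig y).
Proof.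
  split.
  - intros [a [b [Ha [Hb Hp]]]]; exists (proj1_sig a), (proj1_sig b).
    rewrite <- !inner_upair; tauto.
  - intros [a [b [Ha [Hb Hp]]]].
    assert (Ma : a ∈ M) by (apply (trans_M _ (proj2_sig p)), Hp; tauto).
    assert (Mb : b ∈ M) by (apply (trans_M _ (proj2_sig p)), Hp; tauto).
    exists (exist _ a Ma), (exist _ b Mb).
    rewrite !inner_upair; tauto.
Qed.

Lemma inner_maps (f x y : inner M) :
  maps f x y <-> maps (proj1_sig f) (proj1_sig x) (proj1_sig y).
Proof.
  split.
  - intros [p [Hp H]]; exists (proj1_sig p); rewrite <- inner_opair; tauto.
  - intros [p [Hp H]]; exists (exist _ p (trans_M _ (proj2_sig f) _ Hp)).
    rewrite inner_opair; tauto.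
Qed.

Lemma maps_range_inner (f x y : V) : f ∈ M -> maps f x y -> y ∈ M.
Proof.
  intros Hf [p [Hp [a [b [_ [Hb Hab]]]]]].
  assert (Mp : p ∈ M) by exact (trans_M _ Hf _ Hp).
  assert (Mb : b ∈ M) by (apply (trans_M _ Mp), Hab; tauto).
  apply (trans_M _ Mb), Hb; tauto.
Qed.

(** Diagonal argument: the set [D] of points of [X] lying outside their image is a subset of [W],
    hence in [Q], yet it cannot be a value of the surjection. *)
Lemma cantor (W : V) (X Q : inner M) :
  sub_set (proj1_sig X) W -> is_powerset (proj1_sig Q) W -> ~ card_lesssim Q X.
Proof.
  intros HX HQ [N|[f [[F1 F2] F3]]].
  - assert (HW : W ∈ proj1_sig Q) by (apply HQ; intros z Hz; exact Hz).
    exact (N (exist _ W (trans_M _ (proj2_sig Q) _ HW)) HW).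
  - destruct (separation (fun x => forall d, maps (proj1_sig f) x d -> ~ x ∈ d)
      (proj1_sig X)) as [D HD]; [definability|].
    assert (QD : D ∈ proj1_sig Q) by (apply HQ; intros z Hz; apply HX, HD, Hz).
    assert (MD : D ∈ M) by exact (trans_M _ (proj2_sig Q) _ QD).
    destruct (proj1 (F3 (exist _ D MD)) QD) as [x Hx].
    assert (Xx : x ∈ X).
    { destruct Hx as [p [Hp Ho]]; destruct (F1 p Hp) as [x' [y' [Hx' Ho']]].
      apply inner_opair in Ho, Ho'.
      destruct (opair_inj _ _ _ _ _ Ho Ho') as [Ex _].
      apply inner_ext in Ex; subst; exact Hx'. }
    destruct (F2 x Xx) as [d0 [_ U]].
    assert (VD : maps (proj1_sig f) (proj1_sig x) D) by exact (proj1 (inner_maps _ _ _) Hx).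
    assert (ND : ~ proj1_sig x ∈ D).
    { intros H; exact (proj2 (proj1 (HD _) H) D VD H). }
    apply ND, HD; split; [exact Xx|].
    (* The map is known to be single-valued only within [inner M], so [d] is placed in [M] before
       being identified with [D]. *)
    intros d Hd Hxd.
    assert (Md := maps_range_inner _ _ _ (proj2_sig f) Hd).
    assert (Ed : exist _ D MD = exist _ d Md :> inner M).
    { rewrite <- (U (exist _ D MD) Hx); apply U, inner_maps; exact Hd. }
    apply ND; replace D with d; [exact Hxd|].
    exact (f_equal (fun z : inner M => proj1_sig z) (eq_sym Ed)).
Qed.

End Inner.

(** * H-like sets of successor type *)

Section HLike.

Context (M : V) (trans_M : transitive M) (tclosed_M : transitively_closed M)
  (products_M : closed_under_products M) (subsets_M : closed_under_subsets M)
  (regular_M : strongly_regular M).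
Context (k s : V) (k_spec : forall a, a ∈ k <-> in_Ord M a)
  (s_function : function_on s k)
  (s_levels : forall a m, maps s a m -> transitive m /\ m ∈ M)
  (s_increasing : forall a b m n, a ∈ b -> maps s a m -> maps s b n -> sub_set m n)
  (s_cover : forall x, x ∈ M <-> exists a n, maps s a n /\ x ∈ n).
Context (X : inner M) (X_maximal : maximal_cardinality X).

(** * Closure of M under basic set operations *)

(** The ordered pair of [x] and [y] belongs to a product of two elements of [M], and the unordered
    pair is one of its members, so transitivity suffices. *)
Lemma M_upair (x y : V) : x ∈ M -> y ∈ M -> exists p, p ∈ M /\ is_upair p x y.
Proof.
  intros Hx Hy; destruct (tclosed_M _ Hx) as [Z [MZ [_ [_ HZ]]]].
  destruct (tclosed_M _ Hy) as [Z' [MZ' [_ [_ HZ']]]].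
  destruct (products_M _ _ MZ MZ') as [P [MP HP]].
  destruct (opair_exists x y) as [p Hp].
  assert (Mp : p ∈ M).
  { apply (trans_M _ MP), HP; exists x, y; tauto. }
  destruct Hp as [a [b [_ [Hb Hp]]]].
  exists b; split; [apply (trans_M _ Mp), Hp; tauto|exact Hb].
Qed.

(** A transitive [Z] in [M] containing [a] also contains all members of members of [a], so [u] is a
    subset of [Z]. *)
Lemma M_union (a u : V) :
  a ∈ M -> (forall z, z ∈ u -> exists y, y ∈ a /\ z ∈ y) -> u ∈ M.
Proof.
  intros Ha Hu; destruct (tclosed_M _ Ha) as [Z [MZ [TZ [_ HZ]]]].
  apply (subsets_M _ _ MZ); intros z Hz; destruct (Hu z Hz) as [y [Hy Hzy]].
  exact (TZ y (TZ a HZ y Hy) z Hzy).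
Qed.

Lemma M_adjunction (Y a U : V) : Y ∈ M -> a ∈ M -> is_adjunction U Y a -> U ∈ M.
Proof.
  intros HY Ha HU; destruct (M_upair a a Ha Ha) as [p [Mp Hp]].
  destruct (M_upair Y p HY Mp) as [q [Mq Hq]].
  apply (M_union q U Mq); intros z Hz; apply HU in Hz; destruct Hz as [Hz|Hz].
  - exists Y; split; [apply Hq; tauto|exact Hz].
  - exists p; split; [apply Hq; tauto|apply Hp; tauto].
Qed.

Lemma M_empty (e : V) : is_empty e -> e ∈ M.
Proof.
  intros He; apply (subsets_M _ e (proj2_sig X)); intros z Hz; destruct (He z Hz).
Qed.

Lemma M_finite (Z : V) : finite Z -> sub_set Z M -> Z ∈ M.
Proof.
  intros F HZ; apply (finite_induction (fun Y => Y ∈ M) Z);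
    [definability|exact F|exact M_empty|].
  intros Y a U _ Ha HU HY; exact (M_adjunction Y a U HY (HZ a Ha) HU).
Qed.

Lemma k_transitive (a b : V) : a ∈ b -> b ∈ k -> a ∈ k.
Proof.
  intros Hab Hb; apply k_spec in Hb; destruct Hb as [Ob Mb]; apply k_spec; split.
  - exact (ordinal_mem b a Ob Hab).
  - exact (trans_M b Mb a Hab).
Qed.

Lemma k_succ (a b : V) : a ∈ k -> is_adjunction b a a -> b ∈ k.
Proof.
  intros Ha Hb; apply k_spec in Ha; destruct Ha as [Oa Ma]; apply k_spec; split.
  - exact (ordinal_succ a b Oa Hb).
  - exact (M_adjunction a a b Ma Ma Hb).
Qed.

(** * Strong regularity and Replacement in M *)

(* Strong regularity applied to the function sending [x] to the least [a] with [G x a]. *)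
Lemma bounded_choice (G : V -> V -> Prop) (A : V) :
  definable (fun r => G (r 0) (r 1)) -> A ∈ M ->
  (forall x, x ∈ A -> exists a, a ∈ k /\ G x a) ->
  exists b, b ∈ k /\ forall x, x ∈ A -> exists a, a ∈ k /\ G x a /\ (a ∈ b \/ a = b).
Proof.
  intros D MA H.
  destruct (relation_exists
    (fun x a => G x a /\ forall c, c ∈ k -> G x c -> ~ c ∈ a) A k) as [f [F1 F2]];
    [definability|].
  assert (T : forall x, x ∈ A -> exists a, maps f x a).
  { intros x Hx; destruct (minimal_element (fun a => G x a) k) as [a [Ha [Ga Min]]].
    - definability.
    - exact (H x Hx).
    - exists a; apply F2; tauto. }
  destruct (regular_M A f MA) as [b [Hb B]].
  - split; [exact F1|]; intros x Hx; destruct (T x Hx) as [a Ha].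
    exists a; split; [exact Ha|]; intros a' Ha'; apply F2 in Ha, Ha'.
    destruct Ha as [_ [Ka [Ga La]]], Ha' as [_ [Ka' [Ga' La']]].
    destruct (ordinal_compare a a') as [C|[C|C]];
      [apply k_spec, Ka|apply k_spec, Ka'| |exact C|].
    + destruct (La' a Ka Ga C).
    + destruct (La a' Ka' Ga' C).
  - intros x a Ha; apply k_spec; apply F2 in Ha; tauto.
  - exists b; split; [apply k_spec, Hb|]; intros x Hx; destruct (T x Hx) as [a Ha].
    exists a; specialize (B x a Ha); apply F2 in Ha; tauto.
Qed.

Lemma s_domain (a m : V) : maps s a m -> a ∈ k.
Proof.
  intros [p [Hp Ho]]; destruct (proj1 s_function p Hp) as [x [y [Hx Ho']]].
  destruct (opair_inj _ _ _ _ _ Ho Ho'); subst; exact Hx.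
Qed.

(** In [F y x] the value comes first, as in [ax_replacement]. The levels where values appear are
    bounded by some [b], and since levels increase, [B] is a subset of level [b]. *)
Lemma M_replacement (F : V -> V -> Prop) (A B : V) :
  definable (fun r => F (r 0) (r 1)) -> A ∈ M ->
  (forall x y z, x ∈ A -> y ∈ M -> z ∈ M -> F y x -> F z x -> y = z) ->
  (forall y, y ∈ B -> y ∈ M /\ exists x, x ∈ A /\ F y x) -> B ∈ M.
Proof.
  intros D MA Fun HB.
  (* Arguments without a value are discarded, so that a level exists for every element of [A']. *)
  destruct (separation (fun x => exists y, y ∈ M /\ F y x) A) as [A' HA']; [definability|].
  assert (MA' : A' ∈ M).
  { apply (subsets_M A A' MA); intros z Hz; apply HA', Hz. }
  destruct (bounded_choice (fun x a => exists y n, y ∈ M /\ F y x /\ maps s a n /\ y ∈ n) A')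
    as [b [Kb Hb]]; [definability|exact MA'| |].
  - intros x Hx; apply HA' in Hx; destruct Hx as [_ [y [My Fy]]].
    destruct (proj1 (s_cover y) My) as [a [n [Hs Hy]]].
    exists a; split; [exact (s_domain a n Hs)|exists y, n; tauto].
  - destruct (proj2 s_function b Kb) as [m [Hm Um]].
    apply (subsets_M m B); [apply (s_levels b m Hm)|].
    intros y Hy; destruct (HB y Hy) as [My [x [Hx Fy]]].
    destruct (Hb x) as [a [_ [[y' [n [My' [Fy' [Hn Hy']]]]] C]]].
    { apply HA'; split; [exact Hx|exists y; tauto]. }
    (* The bound concerns some value [y'] at [x]; functionality identifies it with [y]. *)
    rewrite (Fun x y y' Hx My My' Fy Fy'); destruct C as [C|C].
    + exact (s_increasing a b n m C Hn Hm y' Hy').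
    + subst a; rewrite (Um n Hn); exact Hy'.
Qed.

(** * A limit ordinal in M *)

(** Instead of gluing chosen witnesses for the members of [x], a single relation collects all pairs
    of [k × M] satisfying [height_le], together with the pair of [n] and [x]. *)
Lemma height_le_intro (n x : V) : n ∈ k -> x ∈ M ->
  (forall y, y ∈ x -> exists m, m ∈ n /\ height_le m y) -> height_le n x.
Proof.
  intros Kn Mx H.
  destruct (relation_exists (fun m y => height_le m y \/ (m = n /\ y = x)) k M)
    as [R [_ HR]]; [definability|].
  exists R; split; [|apply HR; auto].
  intros m y Hmy z Hz; apply HR in Hmy; destruct Hmy as [Km [My C]].
  assert (E : exists j, j ∈ m /\ height_le j z).
  { destruct C as [[S [HS Sy]]|[E1 E2]].
    - destruct (HS m y Sy z Hz) as [j [Hj Sj]]; exists j; split; [exact Hj|].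
      exists S; tauto.
    - subst; exact (H z Hz). }
  destruct E as [j [Hj Hjz]]; exists j; split; [exact Hj|]; apply HR.
  split; [exact (k_transitive j m Hj Km)|]; split; [exact (trans_M y My z Hz)|tauto].
Qed.

Lemma height_le_mem (n x y : V) :
  height_le n x -> y ∈ x -> exists m, m ∈ n /\ height_le m y.
Proof.
  intros [R [HR Rx]] Hy; destruct (HR n x Rx y Hy) as [m [Hm Ry]].
  exists m; split; [exact Hm|]; exists R; tauto.
Qed.

Lemma height_le_mono (m n x : V) :
  m ∈ n -> n ∈ k -> x ∈ M -> height_le m x -> height_le n x.
Proof.
  intros Hmn Kn Mx H; apply height_le_intro; [exact Kn|exact Mx|].
  intros y Hy; destruct (height_le_mem m x y H Hy) as [j [Hj Hjy]].
  exists j; split; [|exact Hjy].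
  apply k_spec in Kn; exact (proj1 (proj1 Kn) m Hmn j Hj).
Qed.

(** In an ∈-minimal counterexample all members have heights; strong regularity bounds them by some
    [b], and the successor of [b] then works for the set itself. *)
Lemma height_le_exists (x : V) : x ∈ M -> exists n, n ∈ k /\ height_le n x.
Proof.
  intros Mx; apply NNPP; intros N.
  destruct (minimal_element (fun x => ~ exists n, n ∈ k /\ height_le n x) M)
    as [y [My [Ny Min]]]; [definability|exists x; tauto|].
  destruct (bounded_choice (fun z n => height_le n z) y) as [b [Kb Hb]];
    [definability|exact My| |].
  - intros z Hz; apply NNPP; intros Nz; exact (Min z (trans_M y My z Hz) Nz Hz).
  - destruct (adjunction_exists b b) as [c Hc].
    assert (Kc := k_succ b c Kb Hc).
    apply Ny; exists c; split; [exact Kc|].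
    apply height_le_intro; [exact Kc|exact My|].
    intros z Hz; destruct (Hb z Hz) as [a [_ [Ha C]]].
    exists a; split; [apply Hc, C|exact Ha].
Qed.

(** A nonempty ordinal that is not a limit has a largest element, and is the successor of it. *)
Lemma zero_or_succ (n : V) : ordinal n -> ~ limit_ordinal n ->
  is_empty n \/ exists m, is_adjunction n m m.
Proof.
  intros On N; destruct (classic (is_empty n)) as [E|E]; [left; exact E|right].
  apply NNPP; intros N'; apply N; split; [exact On|]; split.
  - apply NNPP; intros H; apply E; intros z Hz; apply H; exists z; exact Hz.
  - intros x Hx; apply NNPP; intros H; apply N'; exists x; intros z; split.
    + intros Hz; destruct On as [_ [_ [_ [C _]]]].
      destruct (C z x Hz Hx) as [C'|[C'|C']]; try tauto.
      exfalso; apply H; exists z; tauto.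
    + intros [Hz|Hz]; [exact (proj1 On x Hx z Hz)|subst; exact Hx].
Qed.

Section NoLimit.

Context (no_limit : forall l, l ∈ k -> ~ limit_ordinal l).

Lemma finite_level (n : V) : n ∈ k ->
  forall W, (forall x, x ∈ W <-> x ∈ M /\ height_le n x) -> finite W.
Proof.
  intros Kn; apply NNPP; intros N.
  destruct (minimal_element (fun n => ~ forall W,
    (forall x, x ∈ W <-> x ∈ M /\ height_le n x) -> finite W) k) as [c [Kc [Nc Min]]];
    [definability|exists n; tauto|].
  apply Nc; intros W HW.
  assert (Oc : ordinal c) by apply k_spec, Kc.
  destruct (zero_or_succ c Oc (no_limit c Kc)) as [E|[m Hm]].
  (* Here [c] is itself the empty set, the only set of height at most zero, so [W] is [{c}]. *)
  - apply (finite_adjunction c c W (finite_empty c E)).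
    intros x; rewrite HW; split.
    + intros [Mx Hx]; right; apply extensionality; intros z; split; intros Hz.
      * destruct (height_le_mem c x z Hx Hz) as [j [Hj _]]; destruct (E j Hj).
      * destruct (E z Hz).
    + intros [Hx|Hx]; [destruct (E x Hx)|subst x].
      split; [exact (M_empty c E)|].
      apply height_le_intro; [exact Kc|exact (M_empty c E)|].
      intros y Hy; destruct (E y Hy).
  - assert (Hmc : m ∈ c) by (apply Hm; tauto).
    assert (Km := k_transitive m c Hmc Kc).
    destruct (separation (fun x => height_le m x) M) as [W' HW']; [definability|].
    assert (F : finite W').
    { apply NNPP; intros NF; apply (Min m Km); [|exact Hmc].
      intros H; exact (NF (H W' HW')). }
    assert (MW' : W' ∈ M).
    { apply (M_finite W' F); intros z Hz; apply HW', Hz. }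
    (* [W] is the full power set of [W']: subsets of [W'] lie in [M] because [W'], being finite,
       does. *)
    apply (finite_powerset W' W F); intros x; rewrite HW; split.
    + intros [Mx Hx] y Hy; apply HW'; assert (My := trans_M x Mx y Hy).
      split; [exact My|].
      destruct (height_le_mem c x y Hx Hy) as [j [Hj Hjy]]; apply Hm in Hj.
      destruct Hj as [Hj|Hj]; [|subst; exact Hjy].
      exact (height_le_mono j m y Hj Km My Hjy).
    + intros Hx; assert (Mx := subsets_M W' x MW' Hx); split; [exact Mx|].
      apply height_le_intro; [exact Kc|exact Mx|].
      intros y Hy; exists m; split; [exact Hmc|apply HW', Hx, Hy].
Qed.

Lemma no_limit_absurd : False.
Proof.
  destruct (height_le_exists _ (proj2_sig X)) as [n [Kn Hn]].
  destruct (separation (fun x => height_le n x) M) as [W HW]; [definability|].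
  assert (F := finite_level n Kn W HW).
  destruct (powerset_exists W) as [Q HQ].
  assert (MW : W ∈ M).
  { apply (M_finite W F); intros z Hz; apply HW, Hz. }
  assert (MQ : Q ∈ M).
  { apply (M_finite Q (finite_powerset W Q F HQ)); intros z Hz.
    exact (subsets_M W z MW (proj1 (HQ z) Hz)). }
  (* [n] bounds the height of [X], hence that of its members, so [X] is a subset of [W]. *)
  apply (cantor M trans_M W X (exist _ Q MQ)); [|exact HQ|apply X_maximal].
  intros y Hy; assert (My := trans_M _ (proj2_sig X) y Hy); apply HW; split; [exact My|].
  destruct (height_le_mem n _ y Hn Hy) as [j [Hj Hjy]].
  exact (height_le_mono j n y Hj Kn My Hjy).
Qed.

End NoLimit.

Lemma limit_exists : exists l, l ∈ M /\ limit_ordinal l.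
Proof.
  apply NNPP; intros N; apply no_limit_absurd; intros l Kl Hl.
  apply N; exists l; split; [apply k_spec, Kl|exact Hl].
Qed.

Lemma limit_zero (l : V) : limit_ordinal l -> exists e, e ∈ l /\ is_empty e.
Proof.
  intros [[T _] [Ne _]]; destruct (foundation l Ne) as [e [He N]].
  exists e; split; [exact He|]; intros z Hz; apply N; exists z; split; [|exact Hz].
  exact (T e He z Hz).
Qed.

(** By comparability, otherwise [l] would be the successor of [x], leaving no room for an element of
    [l] above [x], or would be at most [x], giving a membership cycle. *)
Lemma limit_succ (l x y : V) :
  limit_ordinal l -> x ∈ l -> is_adjunction y x x -> y ∈ l.
Proof.
  intros [Ol [_ L]] Hx Hy; destruct (L x Hx) as [z [Hz Hxz]].
  assert (Oy := ordinal_succ x y (ordinal_mem l x Ol Hx) Hy).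
  destruct (ordinal_compare y l Oy Ol) as [C|[C|C]]; [exact C| |].
  - subst y; apply Hy in Hz; destruct Hz as [Hz|Hz].
    + destruct (no_mem_cycle2 _ _ Hz Hxz).
    + subst; destruct (no_mem_self _ Hxz).
  - apply Hy in C; destruct C as [C|C].
    + destruct (no_mem_cycle2 _ _ C Hx).
    + subst; destruct (no_mem_self _ Hx).
Qed.

(** * The axioms in M *)

Lemma M_models : inner M ⊨ ZF_minus_Powerset.
Proof.
  intros ax [| | | | |p|p] rho.
  - cbn; intros x y H; apply inner_ext, extensionality; intros z; split; intros Hz.
    + exact (proj1 (H (exist _ z (trans_M _ (proj2_sig x) _ Hz))) Hz).
    + exact (proj2 (H (exist _ z (trans_M _ (proj2_sig y) _ Hz))) Hz).
  - cbn; intros a [x Hx].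
    destruct (foundation (proj1_sig a)) as [m [Hm N]]; [exists (proj1_sig x); exact Hx|].
    exists (exist _ m (trans_M _ (proj2_sig a) _ Hm)); split; [exact Hm|].
    intros [y Hy]; apply N; exists (proj1_sig y); exact Hy.
  - cbn; intros x y.
    destruct (M_upair _ _ (proj2_sig x) (proj2_sig y)) as [q [Mq Hq]].
    exists (exist _ q Mq); exact (proj2 (inner_upair M trans_M (exist _ q Mq) x y) Hq).
  - cbn; intros a; destruct (union_exists (proj1_sig a)) as [u Hu].
    exists (exist _ u (M_union _ u (proj2_sig a) (fun z => proj1 (Hu z)))).
    intros z; cbn; rewrite Hu; split.
    + intros [y [Hy Hz]]; exists (exist _ y (trans_M _ (proj2_sig a) _ Hy)); tauto.
    + intros [y H]; exists (proj1_sig y); exact H.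
  - cbn; destruct limit_exists as [l [Ml Hl]]; exists (exist _ l Ml); cbn; split.
    + destruct (limit_zero l Hl) as [e [He E]].
      exists (exist _ e (trans_M _ Ml _ He)); split; [exact He|].
      intros z; exact (E (proj1_sig z)).
    + intros x Hx; destruct (adjunction_exists (proj1_sig x) (proj1_sig x)) as [y Hy].
      assert (Ly := limit_succ l _ y Hl Hx Hy).
      exists (exist _ y (trans_M _ Ml _ Ly)); split; [exact Ly|].
      intros z; specialize (Hy (proj1_sig z)); cbn; split.
      * intros H; destruct (proj1 Hy H) as [H'|H']; [left; exact H'|].
        right; apply inner_ext, H'.
      * intros [H|H]; apply Hy; [left; exact H|right; congruence].
  - intros a; set (e := scons (proj1_sig a) (fun n => proj1_sig (rho n))).
    destruct (separation (fun x => relsat M (scons x e) p) (proj1_sig a)) as [b Hb];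
      [apply definable_relsat1|].
    assert (Mb : b ∈ M).
    { apply (subsets_M _ b (proj2_sig a)); intros z Hz; apply Hb, Hz. }
    exists (exist _ b Mb); intros x.
    (* The renaming in the schema skips the index of [b], on which the formula may not depend. *)
    assert (E : sat (scons x (scons (exist _ b Mb) (scons a rho)) : nat -> inner M)
                  (ren (up S) p) <-> relsat M (scons (proj1_sig x) e) p).
    { apply sat_ren_inner; intros [|[|n]]; reflexivity. }
    specialize (Hb (proj1_sig x)); split.
    + intros H; apply Hb in H; split; [apply H|apply E, H].
    + intros [H1 H2]; apply Hb; split; [exact H1|apply E, H2].
  - intros a; set (e := scons (proj1_sig a) (fun n => proj1_sig (rho n))).
    pose (F := fun y x => relsat M (scons y (scons x e)) p).
    assert (DF : definable (fun r => F (r 0) (r 1))) by apply definable_relsat2.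
    intros Fun.
    (* [M] is a set of the universe, so the range is obtained by ambient Separation from [M]; only
       its membership in [M] needs the replacement argument. *)
    destruct (separation (fun y => exists x, x ∈ proj1_sig a /\ F y x) M) as [B HB];
      [definability|].
    assert (MB : B ∈ M).
    { apply (M_replacement F (proj1_sig a) B DF (proj2_sig a)); [|intros y; apply HB].
      intros x y z Hx My Mz Fy Fz.
      assert (Mx := trans_M _ (proj2_sig a) _ Hx).
      specialize (Fun (exist _ x Mx) Hx (exist _ y My) (exist _ z Mz)).
      enough (E : exist _ y My = exist _ z Mz :> inner M)
        by exact (f_equal (fun z : inner M => proj1_sig z) E).
      apply Fun; split.
      (* Of the two candidate values, [ren S] skips [z] and [ren (up S)] skips [y]. *)
      - apply (sat_ren_inner _ _ _ _ (scons y (scons x e))); [|exact Fy].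
        intros [|[|[|n]]]; reflexivity.
      - apply (sat_ren_inner _ _ _ _ (scons z (scons x e))); [|exact Fz].
        intros [|[|[|n]]]; reflexivity. }
    exists (exist _ B MB); intros y.
    assert (E : forall x : inner M,
      sat (scons x (scons y (scons (exist _ B MB) (scons a rho))) : nat -> inner M)
        (ren swap01 p) <-> F (proj1_sig y) (proj1_sig x)).
    { intros x; apply sat_ren_inner; intros [|[|[|n]]]; reflexivity. }
    specialize (HB (proj1_sig y)); split.
    + intros H; apply HB in H; destruct H as [_ [x [Hx Fyx]]].
      exists (exist _ x (trans_M _ (proj2_sig a) _ Hx)); split; [exact Hx|].
      apply E, Fyx.
    + intros [x [Hx H]]; apply HB; split; [apply proj2_sig|].
      exists (proj1_sig x); split; [exact Hx|apply E, H].
Qed.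

End HLike.

End Universe.

Theorem theorem4p12 (V : structure) (V_ZF : V ⊨ ZF) (M : V)
    (M_H_like : H_like M) (M_succ : successor_type M) :
  inner M ⊨ ZF_minus_Powerset.
Proof.
  destruct M_H_like as [T [[TC [P S]] [[_ [k [s [H1 [H2 [H3 [H4 [_ H5]]]]]]]] R]]].
  assert (Reg := R M_succ); destruct M_succ as [X HX].
  exact (M_models V_ZF M T TC P S Reg k s H1 H2 H3 H4 H5 X HX).
Qed.
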